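(* Let $p$ be a prime. As $k \to \infty$, \[ \log_p(\pi_p(k)) \sim \log_p\log_p(k) + \frac{\psi(k)}{\ln p}. \]
   Context: $p_{\le k}(n)$ is the number of partitions of $n$ with at most $k$ parts; $\pi_p(k)$ is the minimal period of the purely periodic sequence $(p_{\le k}(n) \bmod p)_{n \ge 0}$. $\psi$ is the Chebyshev function, $\psi(k) = \ln \operatorname{lcm}(1,\ldots,k)$. $f\sim g$ means $f(k)/g(k)\to 1$. *)

(* Defs.v *)
From mathcomp Require Import all_boot all_order all_algebra.
From mathcomp Require Import all_classical all_reals all_analysis.
Set Implicit Arguments.
Unset Strict Implicit.
Unset Printing Implicit Defensive.
Import Order.TTheory GRing.Theory Num.Theory.
Import numFieldNormedType.Exports.
Local Open Scope classical_set_scope.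
Local Open Scope ring_scope.

Definition is_partition (n : nat) (s : seq nat) : bool :=
  [&& sorted geq s, all (leq 1) s & sumn s == n].

(* k.-bseq 'I_n.+1 is the type of sequences of length at most k with entries
   at most n; a part of a partition of n never exceeds n, so the bound on the
   entries loses nothing. *)
Definition partitions_le (k n : nat) : nat :=
  #|[pred s : k.-bseq 'I_n.+1 | is_partition n [seq val i | i <- s]]|.

Definition is_period (u : nat -> nat) (T : nat) : Prop :=
  (0 < T)%N /\ forall n, u (n + T)%N = u n.

(* The least positive T with u (n + T) = u n for all n, and 0 when u is not
   purely periodic (among the sequences below, with p prime, only for k = 0). *)
Definition min_period (u : nat -> nat) : nat :=
  xget 0%N [set T | is_period u T /\ forall S, is_period u S -> (T <= S)%N].

Definition partition_period (p k : nat) : nat :=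
  min_period (fun n => (partitions_le k n %% p)%N).

(* ln is 0 on nonpositive reals, so logb is total; this only concerns
   finitely many k in an asymptotic statement. *)
Definition logb {R : realType} (b x : R) : R := ln x / ln b.

Definition chebyshev_psi (R : realType) (k : nat) : R :=
  ln (\big[lcmn/1%N]_(1 <= i < k.+1) i)%:R.

Definition asymp_equiv {R : realType} (f g : nat -> R) : Prop :=
  f k / g k @[k --> \oo] --> (1 : R).

(* Main.v *)
Require Import Defs.
From mathcomp Require Import all_boot all_order all_algebra.
From mathcomp Require Import all_classical all_reals all_analysis.
From mathcomp Require Import zify ring lra.
Import Order.TTheory GRing.Theory Num.Theory.
Import numFieldNormedType.Exports.

(* Modulo p the generating series of the partition counts is 1 / Q with
   Q = (1 - X) ... (1 - X^k), and T is a period exactly when Q divides 1 - X^T.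
   Put L = lcm(1, ..., k). Each factor 1 - X^i of Q divides 1 - X^T, so L divides
   every period. Conversely let t be the floor of log_p k; since
   1 - X^i = (1 - X^i')^q with q the p-part of i and i' = i / q, and the p-parts
   of 1, ..., k sum to at most k (t + 1), the product Q divides
   (1 - X^L')^(k (t + 1)) with L' the prime-to-p part of L. This makes L p^s a period
   for some p^s <= p^2 (t + 1). Hence log_p of the period is
   psi(k) / ln p + O(log_p log_p k), and the trivial bound L >= k already
   makes the error negligible. *)

(** * Partitions as lists, and the recurrence in the number of parts *)

Definition parts (k n : nat) : seq (seq nat) :=
  [seq [seq val i | i <- s] |
     s : k.-bseq 'I_n.+1 in [pred s : k.-bseq 'I_n.+1 | is_partition n [seq val i | i <- s]]].

Lemma size_parts k n : size (parts k n) = partitions_le k n.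
Proof. by rewrite size_image. Qed.

Lemma parts_uniq k n : uniq (parts k n).
Proof.
rewrite map_inj_uniq ?enum_uniq // => s t /(inj_map val_inj) e; exact: val_inj.
Qed.

Lemma leq_sumn (s : seq nat) x : x \in s -> x <= sumn s.
Proof.
elim: s => //= y s IH; rewrite inE => /orP[/eqP->|/IH]; first exact: leq_addr.
by move=> h; apply: leq_trans h _; exact: leq_addl.
Qed.

Lemma mem_parts k n s : (s \in parts k n) = is_partition n s && (size s <= k).
Proof.
apply/idP/idP => [/fintype.imageP[t]|/andP[ps sk]].
  by rewrite inE => pt ->; rewrite pt size_map size_bseq.
have ve : [seq val i | i <- [seq inord i : 'I_n.+1 | i <- s]] = s.
  rewrite -map_comp map_id_in // => x xs /=; rewrite inordK // ltnS.
  by case/and3P: ps => _ _ /eqP <-; apply: leq_sumn.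
have szt : size [seq inord i : 'I_n.+1 | i <- s] <= k by rewrite size_map.
by apply/fintype.imageP; exists (Bseq szt); rewrite ?inE /= ve.
Qed.

(** Dropping the zeros of a decremented partition thus loses only a tail, which [raise_parts]
    restores. *)
Lemma sorted_geq_zeros (s : seq nat) : sorted geq s ->
  s = [seq x <- s | 0 < x] ++ nseq (size s - size [seq x <- s | 0 < x]) 0.
Proof.
elim: s => //= x s IH xs; have ss := path_sorted xs.
case: (posnP x) => [x0|xp] /=; last by rewrite subSS -IH.
have z0 : s = nseq (size s) 0.
  apply/all_pred1P/allP => y ys /=; move/(order_path_min (rev_trans leq_trans))/allP/(_ y ys): xs.
  by rewrite /= x0 leqn0.
have -> : [seq y <- s | 0 < y] = [::] by rewrite z0; elim: (size s).
by rewrite x0 /= {1}z0.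
Qed.

(* Adds one to each of exactly [k] parts, a missing part counting as [0]. *)
Definition raise_parts k (s : seq nat) := map S (s ++ nseq (k - size s) 0).

(** The padding zeros become ones, return to zeros and are filtered out. This left inverse makes
    [raise_parts] injective on partitions. *)
Lemma raise_partsK k s : all (leq 1) s ->
  [seq x <- map predn (raise_parts k s) | 0 < x] = s.
Proof.
move=> s1; rewrite /raise_parts -map_comp map_id filter_cat.
rewrite (all_filterP s1); set z := seq.filter _ _; suff -> : z = [::] by rewrite cats0.
by rewrite /z; elim: (k - _).
Qed.

Lemma sumn_raise_parts k s : size s <= k -> sumn (raise_parts k s) = sumn s + k.
Proof.
move=> sk; have sumnS (u : seq nat) : sumn (map S u) = sumn u + size u.
  by elim: u => //= x u ->; lia.
by rewrite sumnS sumn_cat sumn_nseq size_cat size_nseq mul0n addn0 subnKC.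
Qed.

Lemma partitions_le_0 n : partitions_le 0 n = (n == 0).
Proof.
rewrite -size_parts; have [n0|n0] := eqVneq n 0.
  have /perm_size -> : perm_eq (parts 0 n) [:: [::]]; last by [].
  apply: uniq_perm (parts_uniq _ _) _ _ => // s.
  by rewrite mem_parts inE leqn0 size_eq0 n0; case: s => [|x s]; rewrite ?andbF.
case E: (parts 0 n) => [//|s l].
have : s \in parts 0 n by rewrite E mem_head.
rewrite mem_parts leqn0 size_eq0 => /andP[/and3P[_ _ /eqP sn] /eqP s0].
by move: n0; rewrite -sn s0.
Qed.

(* A partition with exactly [k + 1] parts becomes, on decreasing every part
   by one, a partition with at most [k + 1] parts. *)
Lemma partitions_leS k n : partitions_le k.+1 n =
  partitions_le k n + (if k < n then partitions_le k.+1 (n - k.+1) else 0).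
Proof.
pose r := if k < n then [seq raise_parts k.+1 s | s <- parts k.+1 (n - k.+1)] else [::].
have -> : (if k < n then partitions_le k.+1 (n - k.+1) else 0) = size r.
  by rewrite /r; case: ifP => // _; rewrite size_map size_parts.
have size_raise s : size s <= k.+1 -> size (raise_parts k.+1 s) = k.+1.
  by move=> sk; rewrite size_map size_cat size_nseq subnKC.
(* The two lists are disjoint by length: at most [k] parts against exactly [k.+1]. *)
rewrite -!size_parts -size_cat; apply/perm_size/uniq_perm; first exact: parts_uniq.
  rewrite cat_uniq parts_uniq /=; apply/andP; split.
    apply/hasPn => s; rewrite /r; case: ifP => // _ /mapP[t].
    rewrite mem_parts => /andP[_ tk] ->.
    by rewrite mem_parts size_raise // ltnn andbF.
  rewrite /r; case: ifP => // _; rewrite map_inj_in_uniq ?parts_uniq // => s t.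
  rewrite !mem_parts => /andP[/and3P[_ s1 _] _] /andP[/and3P[_ t1 _] _] e.
  by rewrite -(raise_partsK k.+1 s s1) e raise_partsK.
move=> s; rewrite mem_cat !mem_parts; apply/idP/idP.
  case/andP=> ps; rewrite leq_eqVlt ltnS orbC => /orP[->|/eqP szs]; first by rewrite ps.
  apply/orP; right; case/and3P: ps => s_sorted s1 /eqP ss.
  have sS : map S (map predn s) = s.
    by rewrite -map_comp map_id_in // => x /(allP s1) /= /prednK.
  have kn : k < n.
    rewrite -ss -szs -sS; elim: (map predn s) => //= x u h.
    by rewrite size_map in h *; lia.
  set t := [seq x <- map predn s | 0 < x].
  have ms : sorted geq (map predn s).
    by apply: homo_sorted s_sorted => x y /=; lia.
  have szt : size t <= k.+1.
    by rewrite -szs -(size_map predn s) size_filter count_size.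
  have rt : raise_parts k.+1 t = s.
    by rewrite /raise_parts -[k.+1]szs -(size_map predn s) -(sorted_geq_zeros _ ms).
  rewrite /r kn; apply/mapP; exists t; rewrite ?rt // mem_parts szt andbT.
  apply/and3P; split; first by apply: sorted_filter ms; exact: rev_trans leq_trans.
    exact: filter_all.
  by rewrite -ss -rt sumn_raise_parts // addnK.
case/orP=> [/andP[-> /leqW //]|].
rewrite /r; case: ifP => // kn /mapP[t]; rewrite mem_parts => /andP[pt tk] ->.
rewrite size_raise // leqnn andbT; case/and3P: pt => t_sorted _ /eqP st.
apply/and3P; split; last by rewrite sumn_raise_parts // st; apply/eqP; lia.
  have tr : transitive geq by exact: rev_trans leq_trans.
  rewrite /raise_parts sorted_map -(eq_sorted (e := geq)) ?sorted_pairwise //.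
  rewrite pairwise_cat -!sorted_pairwise // t_sorted /=; apply/andP; split.
    by apply/allrelP => x y _ /nseqP[-> _].
  by elim: (k.+1 - size t) => //= m; case: m.
by apply/allP => x /mapP[y _ ->].
Qed.

(** * Periods as divisibility of polynomials *)

Local Open Scope ring_scope.

Lemma coefMr_eq (F : comNzRingType) (r q1 q2 : {poly F}) n :
  (forall i, (i <= n)%N -> q1`_i = q2`_i) -> (r * q1)`_n = (r * q2)`_n.
Proof. by move=> e; rewrite !coefM; apply: eq_bigr => i _; rewrite e ?leq_subr. Qed.

Lemma coef_onesubXnM (F : comNzRingType) (q : {poly F}) m n :
  ((1 - 'X^m) * q)`_n = q`_n - (if (m <= n)%N then q`_(n - m) else 0).
Proof. by rewrite mulrBl mul1r coefB coefXnM ltnNge; case: (m <= n)%N. Qed.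

Definition euler_poly (F : comNzRingType) k : {poly F} := \prod_(i < k) (1 - 'X^(i.+1)).

(** A truncation of the generating series, so that identities between power series become identities
    between low coefficients of polynomials. *)
Definition partition_poly (F : comNzRingType) k N : {poly F} :=
  \poly_(n < N) (partitions_le k n)%:R.

(** Induction on [k]: by [partitions_leS], multiplying the series for [k.+1] by 1 - X^(k+1) gives
    the series for [k]. *)
Lemma coef_euler_partition_poly (F : comNzRingType) k N n : (n < N)%N ->
  (euler_poly F k * partition_poly F k N)`_n = (n == 0%N)%:R.
Proof.
elim: k n => [|k IH] n nN.
  by rewrite /euler_poly big_ord0 mul1r coef_poly nN partitions_le_0.
rewrite /euler_poly big_ord_recr /= -mulrA -IH //.
apply: coefMr_eq => i iN; have {}iN := leq_ltn_trans iN nN.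
rewrite coef_onesubXnM !coef_poly iN partitions_leS natrD.
by case: ifP => _; [rewrite (leq_ltn_trans (leq_subr _ _) iN) addrK | rewrite addr0 subr0].
Qed.

Lemma size_onesubXn (F : comNzRingType) m : (0 < m)%N -> size (1 - 'X^m : {poly F}) = m.+1.
Proof. by move=> m0; rewrite -opprB size_polyN size_XnsubC. Qed.

Lemma size_euler_poly (F : idomainType) k : (0 < k)%N -> (1 < size (euler_poly F k))%N.
Proof.
case: k => // k _; rewrite /euler_poly big_ord_recr /=.
have nz i : (1 - 'X^(i.+1) : {poly F})%R != 0 by rewrite -size_poly_gt0 size_onesubXn.
rewrite size_mul ?nz //; last by apply/prodf_neq0.
rewrite size_onesubXn // addnS /= -/(euler_poly F k).
by rewrite addnS ltnS (leq_trans _ (leq_addr _ _)) // size_poly_gt0; apply/prodf_neq0.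
Qed.

(* With [A] the generating series and [Q] the product, [Q A = 1]; so
   [(1 - X^T) A] is a polynomial [B] of degree below [T] exactly when
   [1 - X^T = Q B]. *)
Lemma period_dvdp (F : fieldType) k T : (0 < k)%N -> (0 < T)%N ->
  (forall n, (partitions_le k (n + T))%:R = (partitions_le k n)%:R :> F)
  <-> euler_poly F k %| 1 - 'X^T.
Proof.
move=> k0 T0; split => [per|].
  suff -> : 1 - 'X^T = partition_poly F k T * euler_poly F k by apply: dvdp_mull.
  rewrite mulrC; apply/polyP => n.
  (* Truncating at degree [n.+1] leaves the coefficient at [n] unchanged. *)
  transitivity ((euler_poly F k * ((1 - 'X^T) * partition_poly F k n.+1))`_n).
    rewrite mulrCA -[LHS](congr1 (fun q : {poly F} => q`_n) (mulr1 _)).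
    by apply: coefMr_eq => i iN; rewrite coef_euler_partition_poly ?coef1.
  apply: coefMr_eq => i iN; rewrite coef_onesubXnM !coef_poly ltnS iN.
  case: (leqP T i) => Ti; last by rewrite subr0.
  by rewrite ltnS (leq_trans (leq_subr _ _) iN) -{1}(subnK Ti) per subrr.
case/dvdpP=> B eB n; apply/eqP; rewrite -subr_eq0; apply/eqP.
(* Since Q has positive degree, deg B < T, so the coefficient of B at n + T vanishes. *)
have sB : (size B <= T)%N.
  have nz : 1 - 'X^T != 0 :> {poly F} by rewrite -size_poly_gt0 size_onesubXn.
  move: (nz); rewrite eB mulf_eq0 negb_or => /andP[B0 Q0].
  have := size_mul B0 Q0; rewrite -eB size_onesubXn //.
  move: (size_euler_poly F k k0); move: (size _) (size _) => b q; lia.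
have := coef_onesubXnM _ (partition_poly F k (n + T).+1) T (n + T).
rewrite leq_addl addnK !coef_poly ltnSn ltnS leq_addr => <-.
rewrite eB -mulrA (coefMr_eq _ _ _ 1); last first.
  by move=> i iN; rewrite coef_euler_partition_poly ?coef1.
by rewrite mulr1 nth_default // (leq_trans sB) ?leq_addl.
Qed.

Lemma dvdp_onesubXn (F : idomainType) m n : (m %| n)%N ->
  (1 - 'X^m : {poly F}) %| 1 - 'X^n.
Proof.
move/dvdnP => [q ->]; rewrite mulnC exprM.
have := subrXX (1 : {poly F}) 'X^m q; rewrite expr1n => ->.
exact: dvdp_mulr.
Qed.

(** Reducing the exponent modulo [m] leaves 1 - X^r with r < m, which by degree must be zero. *)
Lemma dvdn_onesubXn (F : fieldType) m n : (0 < m)%N ->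
  (1 - 'X^m : {poly F}) %| 1 - 'X^n -> (m %| n)%N.
Proof.
move=> m0 d; set r := (n %% m)%N.
have : (1 - 'X^m : {poly F}) %| 1 - 'X^r.
  have e : 1 - 'X^n = (1 - 'X^(n %/ m * m)) * 'X^r + (1 - 'X^r) :> {poly F}.
    by rewrite {1}(divn_eq n m) exprD; ring.
  by move: d; rewrite e dvdp_addr // dvdp_mulr // dvdp_onesubXn // dvdn_mull.
case: (posnP r) => [r0 _|r0 /dvdp_leq]; first by rewrite /dvdn -/r r0.
rewrite -size_poly_gt0 !size_onesubXn // => /(_ isT).
by rewrite ltnS leqNgt /r ltn_pmod.
Qed.

Lemma onesubXn_pchar (F : idomainType) p m a : p \in [pchar F] ->
  1 - 'X^(m * p ^ a) = (1 - 'X^m) ^+ (p ^ a) :> {poly F}.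
Proof.
move=> pF; have pP : p \in [pchar {poly F}] by rewrite pchar_poly.
have pn : [pchar {poly F}].-nat (p ^ a)%N.
  by rewrite pnatX pnatE ?(pcharf_prime pF) // pP.
by rewrite exprM exprDn_pchar // exprNn_pchar // expr1n.
Qed.

(** * The least common multiple and an explicit period *)

Definition lcm_upto k : nat := \big[lcmn/1%N]_(1 <= i < k.+1) i.

Lemma lcm_uptoS k : lcm_upto k.+1 = lcmn (lcm_upto k) k.+1.
Proof. by rewrite /lcm_upto big_nat_recr. Qed.

Lemma lcm_upto_gt0 k : (0 < lcm_upto k)%N.
Proof.
by elim: k => [|k IH]; [rewrite /lcm_upto big_geq | rewrite lcm_uptoS lcmn_gt0 IH].
Qed.

Lemma dvdn_lcm_upto k i : (0 < i <= k)%N -> (i %| lcm_upto k)%N.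
Proof.
elim: k => [|k IH]; first by lia.
rewrite lcm_uptoS => /andP[i0]; rewrite leq_eqVlt => /orP[/eqP->|ik]; first exact: dvdn_lcmr.
by rewrite (dvdn_trans _ (dvdn_lcml _ _)) // IH // i0.
Qed.

Lemma lcm_upto_dvdn k m : (forall i, (0 < i <= k)%N -> (i %| m)%N) -> (lcm_upto k %| m)%N.
Proof.
elim: k => [|k IH] h; first by rewrite /lcm_upto big_geq // dvd1n.
rewrite lcm_uptoS dvdn_lcm (h k.+1) ?leqnn ?andbT //.
by apply: IH => i ik; apply: h; lia.
Qed.

Lemma leq_lcm_upto k : (k <= lcm_upto k)%N.
Proof.
case: k => // k; apply: dvdn_leq; first exact: lcm_upto_gt0.
by apply: dvdn_lcm_upto; rewrite leqnn.
Qed.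

(** Bound the p-part of i by the sum of all p^a dividing i with a <= t, and exchange sums: each a
    contributes p^a floor(k / p^a) <= k. *)
Lemma sum_partn_leq p k : prime p ->
  (\sum_(1 <= i < k.+1) i`_p <= k * (trunc_log p k).+1)%N.
Proof.
move=> pp; have p1 := prime_gt1 pp; set t := trunc_log p k.
apply: (@leq_trans (\sum_(1 <= i < k.+1) \sum_(a < t.+1) p ^ a * (p ^ a %| i))%N).
  rewrite big_nat [leqRHS]big_nat; apply: leq_sum => i /andP[i0 ik].
  have lt : (logn p i < t.+1)%N.
    rewrite ltnS; apply: trunc_log_max => //; rewrite -ltnS; apply: leq_ltn_trans ik.
    by rewrite dvdn_leq // pfactor_dvdnn.
  by rewrite (bigD1 (Ordinal lt)) //= p_part pfactor_dvdnn muln1 leq_addr.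
rewrite exchange_big /= -[t.+1 in leqRHS]card_ord mulnC -sum_nat_const.
apply: leq_sum => a _; rewrite -big_distrr /= -divn_count_dvd mulnC.
exact: leq_divM.
Qed.

Lemma euler_poly_dvdp (p k : nat) (t := trunc_log p k) : prime p ->
  euler_poly 'F_p k %| 1 - 'X^(lcm_upto k * p ^ (trunc_log p t.+1).+2).
Proof.
move=> pp; have p1 := prime_gt1 pp; have pF : p \in [pchar 'F_p] by exact: pchar_Fp.
have [->|k0] := posnP k; first by rewrite /euler_poly big_ord0 dvd1p.
pose L := lcm_upto k; pose y : {poly 'F_p} := 1 - 'X^(L`_p^'); set s := (trunc_log p t.+1).+2.
have L0 : (0 < L)%N := lcm_upto_gt0 k.
have tL : (t <= logn p L)%N.
  rewrite -pfactor_dvdn // dvdn_lcm_upto // expn_gt0 prime_gt0 //=.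
  exact: trunc_logP.
rewrite -/L; have -> : (L * p ^ s = L`_p^' * p ^ (logn p L + s))%N.
  by rewrite -{1}(partnC p L0) p_part mulnAC mulnC -expnD.
rewrite onesubXn_pchar // -/y.
apply: (@dvdp_trans _ (y ^+ (\sum_(1 <= i < k.+1) i`_p))); last first.
  (* Here k < p^(t+1) and t + 1 < p^(s-1), so k (t + 1) <= p^(t+s), while t <= [logn p L]. *)
  apply: dvdp_exp2l; apply: leq_trans (sum_partn_leq p k pp) _.
  apply: (@leq_trans (p ^ t.+1 * p ^ (trunc_log p t.+1).+1)%N).
    by apply: leq_mul; apply/ltnW; exact: trunc_log_ltn.
  by rewrite -expnD leq_pexp2l ?prime_gt0 // addSnnS leq_add2r.
rewrite expr_sum big_add1 big_mkord /euler_poly.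
apply: (big_ind2 (fun q r : {poly 'F_p} => q %| r)); first exact: dvdpp.
  by move=> *; exact: dvdp_mul.
move=> i _; have i0 : (0 < i.+1)%N by [].
rewrite -{1}(partnC p i0) mulnC p_part onesubXn_pchar //.
apply: dvdp_exp2r; apply: dvdp_onesubXn; apply: partn_dvd => //.
by apply: dvdn_lcm_upto; rewrite ltn_ord.
Qed.

(** * Two-sided bounds for the minimal period *)

Lemma natr_Fp_eq p m n : prime p -> (m%:R = n%:R :> 'F_p) <-> (m %% p = n %% p)%N.
Proof.
move=> pp; split => [/(congr1 val)|e]; first by rewrite /= !val_Fp_nat.
by apply: val_inj; rewrite /= !val_Fp_nat.
Qed.

Lemma is_period_dvdp p k T : prime p -> (0 < k)%N ->
  is_period (fun n => (partitions_le k n %% p)%N) T <->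
  (0 < T)%N /\ euler_poly 'F_p k %| 1 - 'X^T.
Proof.
move=> pp k0; split=> -[T0 h]; split=> //.
  by apply/period_dvdp => // n; apply/natr_Fp_eq.
by move=> n; apply/natr_Fp_eq => //; move: n; apply/period_dvdp.
Qed.

(** The existence of one period rules out the default value 0 of [xget]. *)
Lemma min_periodP (u : nat -> nat) T : is_period u T ->
  is_period u (min_period u) /\ (min_period u <= T)%N.
Proof.
move=> uT; have ex : exists n, `[< is_period u n >] by exists T; exact/asboolP.
have [m /asboolP um mm] := ex_minnP ex.
have [|us us_min] := @xgetI _ 0%N
  (fun S => is_period u S /\ forall S', is_period u S' -> (S <= S')%N) m.
- by split=> // S /asboolP; exact: mm.
- by split=> //; exact: us_min.
Qed.

Lemma partition_period_bounds p k (T := partition_period p k) : prime p -> (0 < k)%N ->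
  (lcm_upto k <= T <= lcm_upto k * (p ^ 2 * (trunc_log p k).+1))%N.
Proof.
move=> pp k0; have p1 := prime_gt1 pp; have L0 := lcm_upto_gt0 k.
set s := (trunc_log p (trunc_log p k).+1).+2.
have : is_period (fun n => (partitions_le k n %% p)%N) (lcm_upto k * p ^ s).
  apply/is_period_dvdp => //; split; last exact: euler_poly_dvdp.
  by rewrite muln_gt0 L0 expn_gt0 prime_gt0.
case/min_periodP; rewrite -/(partition_period p k) -/T.
case/is_period_dvdp => // T0 QT TL; apply/andP; split.
  apply: dvdn_leq => //; apply: lcm_upto_dvdn => i /andP[i0 ik].
  apply: (@dvdn_onesubXn 'F_p) => //; apply: dvdp_trans QT.
  have ik' : (i.-1 < k)%N by rewrite prednK.
  by rewrite /euler_poly (bigD1 (Ordinal ik')) //= prednK // dvdp_mulr.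
apply: leq_trans TL _; rewrite leq_mul2l /s -addn2 addnC expnD leq_mul2l.
by rewrite trunc_logP ?orbT.
Qed.

(** * Asymptotics of the logarithm of the period *)

Local Open Scope classical_set_scope.

(** Write ln x = 2 ln (sqrt x). The square root is a convenient scale between the iterated logarithm
    and the main term. *)
Lemma ln_le_2sqrt (R : realType) (x : R) : 0 < x -> ln x <= 2 * Num.sqrt x.
Proof.
move=> x0; have s0 : 0 < Num.sqrt x by rewrite sqrtr_gt0.
rewrite -{1}(sqr_sqrtr (ltW x0)) lnXn // mulr_natl ler_pMn2r //.
exact/ltW/ln_sublinear.
Qed.

(** The relative error is at most C sqrt(x) / g <= C / sqrt(x), which tends to 0. *)
Lemma asymp_equiv_ratio_le (R : realType) (f g x : nat -> R) (C : R) :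
  x k @[k --> \oo] --> +oo ->
  (\forall k \near \oo, x k <= g k /\ `|f k - g k| <= C * Num.sqrt (x k)) ->
  asymp_equiv f g.
Proof.
move=> /cvgryPge xoo fg; apply/cvgrPdist_le => e e0; near=> k.
have [xg fgk] : x k <= g k /\ `|f k - g k| <= C * Num.sqrt (x k) by near: k.
(* The square ensures C <= e sqrt(x), and the added 1 ensures x > 0. *)
have xA : 1 + (C / e) ^+ 2 <= x k by near: k; exact: xoo.
have x0 : 0 < x k by apply: lt_le_trans xA; rewrite ltr_pwDl ?sqr_ge0.
have g0 : 0 < g k := lt_le_trans x0 xg.
have -> : 1 - f k / g k = - ((f k - g k) / g k) by field; rewrite gt_eqF.
rewrite normrN normrM normfV (gtr0_norm g0) ler_pdivrMr // (le_trans fgk) //.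
have Ce : C <= e * Num.sqrt (x k).
  rewrite -ler_pdivrMl // mulrC (le_trans (ler_norm _)) // -sqrtr_sqr ler_wsqrtr //.
  by rewrite (le_trans _ xA) // lerDr.
apply: (@le_trans _ _ (e * x k)); last by rewrite ler_pM2l.
by rewrite -{2}(sqr_sqrtr (ltW x0)) expr2 mulrA ler_wpM2r ?sqrtr_ge0.
Unshelve. all: by end_near.
Qed.

Lemma cvg_logb_natr (R : realType) (b : R) : 1 < b -> logb b k%:R @[k --> \oo] --> +oo.
Proof.
move=> b1; have lb : 0 < ln b by rewrite ln_gt0.
apply/cvgryPge => A; near=> k.
have k0 : 0 < k%:R :> R by rewrite ltr0n; near: k; exact: nbhs_infty_gt.
rewrite /logb ler_pdivlMr // -[leLHS]expRK ler_ln ?posrE ?expR_gt0 //.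
by near: k; exact: nbhs_infty_ger.
Unshelve. all: by end_near.
Qed.

(** Take logarithms in [partition_period_bounds]: the factor p^2 (t + 1) adds 2 + log_p (t + 1) <= 3
    + log_p x. The condition p <= k gives x >= 1, hence log_p x >= 0. *)
Lemma logb_partition_period (R : realType) p k (x : R := logb p%:R k%:R)
    (g : R := logb p%:R x + chebyshev_psi R k / ln p%:R) : prime p -> (p <= k)%N ->
  x <= g /\ `|logb p%:R (partition_period p k)%:R - g| <= 3 + logb p%:R x.
Proof.
move=> pp pk; have p1 := prime_gt1 pp; have k0 : (0 < k)%N by lia.
have /andP[LT TU] := partition_period_bounds p k pp k0.
rewrite /g /chebyshev_psi -/(lcm_upto k); clear g.
have L0 := lcm_upto_gt0 k; have kL := leq_lcm_upto k.
have tk := trunc_logP p1 k0.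
move: (lcm_upto k) (partition_period p k) (trunc_log p k) => L T t in LT TU L0 kL tk *.
have lp : 0 < ln p%:R :> R by rewrite ln_gt0 // ltr1n.
have lnle m n : (0 < m)%N -> (m <= n)%N -> ln m%:R <= ln n%:R :> R.
  by move=> m0 mn; rewrite ler_ln ?posrE ?ltr0n ?ler_nat // (leq_trans m0).
have logle m n : (0 < m)%N -> (m <= n)%N -> logb p%:R m%:R <= logb p%:R n%:R :> R.
  by move=> m0 mn; rewrite ler_pdivrMr // divfK ?gt_eqF // lnle.
have logpp : logb p%:R p%:R = 1 :> R by rewrite /logb divff ?gt_eqF.
have logM (y z : R) : 0 < y -> 0 < z -> logb p%:R (y * z) = logb p%:R y + logb p%:R z.
  by move=> y0 z0; rewrite /logb lnM ?posrE // mulrDl.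
have logX (y : R) n : 0 < y -> logb p%:R (y ^+ n) = n%:R * logb p%:R y.
  by move=> y0; rewrite /logb lnXn // mulrA mulr_natl.
have pos n : (0 < n)%N -> 0 < n%:R :> R by rewrite ltr0n.
have x1 : 1 <= x by rewrite -logpp logle // prime_gt0.
have lx0 : 0 <= logb p%:R x by apply: divr_ge0; [exact: ln_ge0 | exact: ltW].
have kx : x <= logb p%:R L%:R by apply: logle.
have tx : t%:R <= x.
  have /logle : (0 < p ^ t)%N by rewrite expn_gt0 prime_gt0.
  by move/(_ _ tk); rewrite natrX logX ?pos ?prime_gt0 // logpp mulr1.
(* From t <= x and 1 <= x follows t + 1 <= 2 x <= p x. *)
have lt : logb p%:R t.+1%:R <= 1 + logb p%:R x.
  have x0 := lt_le_trans ltr01 x1; have p0 := pos _ (prime_gt0 pp).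
  have -> : 1 + logb p%:R x = logb p%:R (p%:R * x) by rewrite logM // logpp.
  rewrite ler_pdivrMr // divfK ?gt_eqF // ler_ln ?posrE ?pos ?(mulr_gt0 p0 x0) //.
  have p2 : 2 <= p%:R :> R by rewrite (ler_nat _ 2).
  by rewrite -natr1; nra.
have LT' := logle _ _ L0 LT.
have TU' : logb p%:R T%:R <= logb p%:R L%:R + (2 + logb p%:R t.+1%:R) :> R.
  have := logle _ _ (leq_trans L0 LT) TU.
  by rewrite !natrM !logM ?mulr_gt0 ?pos ?(prime_gt0 pp) // logpp => ?; lra.
rewrite -/(logb p%:R L%:R); split; first by lra.
by rewrite ler_norml; apply/andP; split; lra.
Qed.

Theorem theorem6p3 (R : realType) (p : nat) (hp : prime p) :
  asymp_equiv
    (fun k : nat => logb (p%:R : R) (partition_period p k)%:R)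
    (fun k : nat => logb (p%:R : R) (logb (p%:R : R) k%:R)
                    + chebyshev_psi R k / ln (p%:R : R)).
Proof.
have p1 : 1 < p%:R :> R by rewrite ltr1n prime_gt1.
have lp : 0 < ln p%:R :> R by rewrite ln_gt0.
have xoo := cvg_logb_natr R _ p1.
(* Once x >= 1, the term 3 is at most 3 sqrt(x), and log_p x <= (2 / ln p) sqrt(x). *)
apply: (asymp_equiv_ratio_le R _ _ (fun k => logb p%:R k%:R) (3 + 2 / ln p%:R) xoo).
near=> k; have [|xg fg] := logb_partition_period R p k hp.
  by near: k; exact: nbhs_infty_ge.
split=> //; apply: le_trans fg _.
have x1 : 1 <= logb p%:R k%:R :> R by near: k; move/cvgryPge : xoo; exact.
rewrite mulrDl lerD //; first by rewrite ler_peMr // -[leLHS]sqrtr1 ler_wsqrtr.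
rewrite mulrAC ler_pM2r ?invr_gt0 // ln_le_2sqrt //.
exact: lt_le_trans x1.
Unshelve. all: by end_near.
Qed.
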